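(* For $\bm{\eta}=(\sigma,\delta,\tau,\mu,\kappa,\lambda)^T$ let $$f(\theta,x|\bm{\eta})=\{1+\lambda\sin(\theta-\mu)\}\,\frac{\sqrt{1-\kappa^2}}{2\pi\sigma\delta}\left(\frac{x}{\sigma}\right)^{1/\delta-1}\left[1+\frac{\tau}{\delta}\left(\frac{x}{\sigma}\right)^{1/\delta}\{1-\kappa\cos(\theta-\mu)\}\right]^{-(\delta/\tau+1)}$$ be the density of the sine-skewed generalized Pareto-type cylindrical distribution of a pair $(\Theta,X)$, and let $$\Gamma_{\mathrm{ISA}}=\{(\sigma,\delta,\tau,\mu,\kappa,\lambda)^T\mid\sigma>0,\ \delta>0,\ \tau>0,\ 0\le\mu<2\pi,\ 0<\kappa<1,\ -1\le\lambda\le1\}.$$ Then the family $\{f(\theta,x|\bm{\eta})\mid\bm{\eta}\in\Gamma_{\mathrm{ISA}}\}$ is identifiable.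
   Context: Here $\theta\in[-\pi,\pi)$ (identified with the unit circle) and $x$ ranges over the non-negative real line, and the density is with respect to Lebesgue measure $d\theta\,dx$. Identifiability: a family $\{f(\cdot|\bm{\eta})\mid\bm{\eta}\in\Gamma\}$ of densities is identifiable if $\bm{\eta}_1\neq\bm{\eta}_2$ in $\Gamma$ implies that $f(\cdot|\bm{\eta}_1)$ and $f(\cdot|\bm{\eta}_2)$ define different distributions (different cumulative distribution functions; equivalently, the densities are not equal almost everywhere). *)

(* Defs.v *)
From HB Require Import structures.
From mathcomp Require Import all_boot all_order all_algebra.
From mathcomp Require Import all_classical all_reals all_analysis.
Set Implicit Arguments.
Unset Strict Implicit.
Unset Printing Implicit Defensive.
Import Order.TTheory GRing.Theory Num.Theory.
Import numFieldNormedType.Exports.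
Local Open Scope classical_set_scope.
Local Open Scope ring_scope.

(* The circle is represented by the half-open interval [-pi, pi). *)
Definition cylinder (R : realType) : set (R * R) :=
  `[- pi, pi[ `*` `[0, +oo[.

(* The law on R^2 of a pair (Theta, X) with density f with respect to
   d theta d x on the cylinder; f is irrelevant outside the cylinder. *)
Definition law (R : realType) (f : R * R -> R) (A : set (R * R)) : \bar R :=
  (\int[(@lebesgue_measure R \x @lebesgue_measure R)%E]_(p in A `&` @cylinder R)
     (f p)%:E)%E.

(* P (Theta <= t, X <= x) *)
Definition cdf (R : realType) (f : R * R -> R) (t x : R) : \bar R :=
  law f (`]-oo, t] `*` `]-oo, x]).

Definition identifiable (R : realType) (P : Type) (Gamma : set P)
    (f : P -> R * R -> R) : Prop :=
  forall eta1 eta2 : P, Gamma eta1 -> Gamma eta2 -> eta1 <> eta2 ->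
    cdf (f eta1) <> cdf (f eta2).

Record param (R : realType) := Param {
  sigma : R; delta : R; tau : R; mu : R; kappa : R; lambda : R }.

Definition Gamma_ISA (R : realType) : set (param R) :=
  [set eta | [/\ 0 < sigma eta, 0 < delta eta, 0 < tau eta &
             [/\ 0 <= mu eta < 2 * pi, 0 < kappa eta < 1
               & -1 <= lambda eta <= 1]]].

Definition ssGPT_density (R : realType) (eta : param R) (p : R * R) : R :=
  let: Param sigma delta tau mu kappa lambda := eta in
  let: (theta, x) := p in
  (1 + lambda * sin (theta - mu))
  * (Num.sqrt (1 - kappa ^+ 2) / (2 * pi * sigma * delta))
  * (x / sigma) `^ (delta^-1 - 1)
  * (1 + tau / delta * (x / sigma) `^ delta^-1
           * (1 - kappa * cos (theta - mu))) `^ (- (delta / tau + 1)).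

(* Main.v *)
Require Import Defs.
From HB Require Import structures.
From mathcomp Require Import all_boot all_order all_algebra.
From mathcomp Require Import all_classical all_reals all_analysis.
From mathcomp Require Import measurable_realfun.
From mathcomp Require Import ring lra.
Set Implicit Arguments.
Unset Strict Implicit.
Unset Printing Implicit Defensive.
Import Order.TTheory GRing.Theory Num.Theory.
Import numFieldNormedType.Exports.
Local Open Scope classical_set_scope.
Local Open Scope ring_scope.

(** Suppose that two parameters [eta1], [eta2] give the same distribution
    function.  The proof recovers the density at every interior point of the
    cylinder, and then reads the six parameters off the density.

    From distribution function to density.  The density is dominated by
    [K * x `^ (1 / delta - 1)], which is integrable near [0] because
    [1 / delta > 0]; so the distribution function is finite
    ([cdf_density_lty]) and differences of it give the mass of every bounded
    rectangle ([cdf_determines_rect]).  If the two densities differed at an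
    interior point, continuity would keep them apart by a gap on a small
    rectangle, whose two masses would then differ ([cdf_le_density]).

    From density to parameters.  For a fixed angle [t] the density is, as a
    function of [x > 0], a profile [C * x `^ (d - 1) * (1 + A * x `^ d) `^ (- p)]
    with [d = 1 / delta], [p = delta / tau + 1], where [C] is proportional to
    [1 + lambda * sin (t - mu)] and [A] to [1 - kappa * cos (t - mu)].  Such a
    profile, with positive [C], [d], [A] and [p], determines all four of them
    ([radial_profile_inj]): [d] and [C] are seen at [x -> 0], [p] at [x -> oo],
    and [A] at any single point.  This gives [delta] and [tau].  As [t] varies,
    [A] is a function [a + b * cos t + c * sin t] known at every angle where
    the skewing factor does not vanish.  At most one angle is lost in this way,
    so the coefficients are known as well ([trig_affine_eq0]).  The constant
    coefficient gives [sigma]; the other two give the vector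
    [kappa * (cos mu, sin mu)], hence [kappa] as its length, which is positive,
    and [mu] as its argument ([polar_angle_inj]).  The same lemma applied to
    [C] finally gives [lambda]. *)

(** * Radial profiles *)

Lemma slope_le0 (R : realType) (a b : R) :
  (forall s, 0 <= s -> a * s <= b) -> a <= 0.
Proof.
move=> ab; rewrite leNgt; apply/negP => a0.
have /ab : 0 <= (`|b| + 1) / a by rewrite divr_ge0 ?addr_ge0 // ltW.
rewrite mulrC mulfVK ?gt_eqF //.
by have := ler_norm b; lra.
Qed.

Lemma le0_of_le_mulr (R : realType) (a b : R) :
  (forall y, 0 < y -> a <= b * y) -> a <= 0.
Proof.
move=> ab; rewrite leNgt; apply/negP => a0.
have b0 : 0 < b by have := ab 1 ltr01; lra.
have /ab : 0 < a / (b + b) by rewrite divr_gt0 // addr_gt0.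
have -> : b * (a / (b + b)) = a / 2 by field; lra.
lra.
Qed.

(** The shape of the density along a ray of constant angle.  For [p > 1] it is,
    up to a constant factor, the density of a variable whose [d]-th power has a
    generalised Pareto law. *)
Definition radial_profile (R : realType) (C d A p x : R) : R :=
  C * x `^ (d - 1) * (1 + A * x `^ d) `^ (- p).

Lemma powR_expR (R : realType) (s a : R) : expR s `^ a = expR (a * s).
Proof. by rewrite /powR gt_eqF ?expR_gt0 // expRK. Qed.

(** In the variable [s = ln x] the logarithm of a profile is an affine function
    minus the soft-plus term [p * ln (1 + A * expR (d * s))], which is negligible
    at [-oo] and asymptotically affine at [+oo]. *)
Lemma ln_radial_profile (R : realType) (C d A p s : R) : 0 < C -> 0 < A ->
  ln (radial_profile C d A p (expR s)) =
  ln C + (d - 1) * s - p * ln (1 + A * expR (d * s)).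
Proof.
move=> C0 A0; have e0 := expR_gt0 (d * s).
have B0 : 0 < 1 + A * expR (d * s) by nra.
rewrite /radial_profile !powR_expR !lnM ?posrE ?mulr_gt0 ?powR_gt0 ?expR_gt0 //.
by rewrite expRK ln_powR mulNr.
Qed.

Lemma ln1D_bounds (R : realType) (A y : R) : 0 < A -> 0 < y ->
  0 <= ln (1 + A * y) <= A * y.
Proof.
move=> A0 y0; have Ay := mulr_gt0 A0 y0.
by rewrite ln_ge0 ?le_ln1Dx //=; lra.
Qed.

Lemma ln1D_expR_bounds (R : realType) (A u : R) : 0 < A -> 0 <= u ->
  u + ln A <= ln (1 + A * expR u) <= u + ln (1 + A).
Proof.
move=> A0 u0; have e1 : 1 <= expR u by rewrite -expR0 ler_expR.
have lnE B : 0 < B -> u + ln B = ln (expR u * B).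
  by move=> B0; rewrite lnM ?posrE ?expR_gt0 // expRK.
have A1 : 0 < 1 + A by lra.
have Ae : 0 < A * expR u by rewrite mulr_gt0 ?expR_gt0.
rewrite !lnE // !ler_ln ?posrE ?mulr_gt0 ?expR_gt0 //; last 2 first.
- by lra.
- by lra.
by apply/andP; split; nra.
Qed.

(** The first three lemmas give inequalities only: [eq12] is symmetric in the
    two profiles, so the equalities follow by exchanging them. *)
Section profile_comparison.
Variables (R : realType) (C1 d1 A1 p1 C2 d2 A2 p2 : R).
Hypotheses (C10 : 0 < C1) (A10 : 0 < A1) (d10 : 0 < d1) (p10 : 0 < p1).
Hypotheses (C20 : 0 < C2) (A20 : 0 < A2) (d20 : 0 < d2) (p20 : 0 < p2).
Hypothesis eq12 : forall x : R, 0 < x ->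
  radial_profile C1 d1 A1 p1 x = radial_profile C2 d2 A2 p2 x.

Let eq_ln s : ln C1 + (d1 - 1) * s - p1 * ln (1 + A1 * expR (d1 * s)) =
  ln C2 + (d2 - 1) * s - p2 * ln (1 + A2 * expR (d2 * s)).
Proof.
have e1 := ln_radial_profile d1 p1 s C10 A10.
have e2 := ln_radial_profile d2 p2 s C20 A20.
exact: etrans (esym e1) (etrans (congr1 (@ln R) (eq12 (expR_gt0 s))) e2).
Qed.

(** At [s -> -oo] the soft-plus terms stay bounded, so the slopes [d - 1]
    can be compared. *)
Lemma profile_exponent_le : d2 <= d1.
Proof.
rewrite -subr_le0; apply: (@slope_le0 _ _ (ln C2 - ln C1 + p1 * A1)) => t t0.
have := eq_ln (- t).
have [/andP[a1 b1] /andP[a2 b2]] := (ln1D_bounds A10 (expR_gt0 (d1 * - t)),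
  ln1D_bounds A20 (expR_gt0 (d2 * - t))).
have e1 : expR (d1 * - t) <= 1.
  by rewrite -expR0 ler_expR mulrN oppr_le0 mulr_ge0 // ltW.
have : p1 * ln (1 + A1 * expR (d1 * - t)) <= p1 * A1.
  by rewrite ler_pM2l // (le_trans b1) // ler_piMr // ltW.
have := mulr_ge0 (ltW p20) a2.
lra.
Qed.

(** With equal slopes, [ln C1] exceeds [ln C2] by at most [p1 * A1 * y], where
    [y = x `^ d1] is arbitrarily small. *)
Lemma profile_constant_le : d1 = d2 -> ln C1 <= ln C2.
Proof.
move=> d12; rewrite -subr_le0; apply: (@le0_of_le_mulr _ _ (p1 * A1)) => y y0.
have := eq_ln (ln y / d1).
have -> : d2 = d1 by [].
rewrite [d1 * (_ / _)]mulrC mulfVK ?gt_eqF // lnK ?posrE //.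
have [/andP[a1 b1] /andP[a2 b2]] := (ln1D_bounds A10 y0, ln1D_bounds A20 y0).
have := mulr_ge0 (ltW p20) a2.
have : p1 * ln (1 + A1 * y) <= p1 * A1 * y by rewrite -mulrA ler_pM2l.
lra.
Qed.

(** At [u -> +oo] the soft-plus terms have slope [p] in [u = d1 * s]. *)
Lemma profile_tail_le : d1 = d2 -> ln C1 = ln C2 -> p1 <= p2.
Proof.
move=> d12 C12; rewrite -subr_le0.
apply: (@slope_le0 _ _ (p2 * ln (1 + A2) - p1 * ln A1)) => u u0.
have := eq_ln (u / d1).
rewrite -d12 C12 [d1 * (_ / _)]mulrC mulfVK ?gt_eqF // => e.
have /andP[a1 _] := ln1D_expR_bounds A10 u0.
have /andP[_ b2] := ln1D_expR_bounds A20 u0.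
have := ler_wpM2l (ltW p10) a1; have := ler_wpM2l (ltW p20) b2.
lra.
Qed.

Lemma profile_scale_eq : d1 = d2 -> ln C1 = ln C2 -> p1 = p2 -> A1 = A2.
Proof.
move=> d12 C12 p12; have := eq_ln 0.
rewrite -d12 C12 -p12 !mulr0 expR0 !mulr1 => /addrI/oppr_inj.
move/(mulfI (lt0r_neq0 p10)) => ln12.
by apply: (@addrI _ 1); apply: ln_inj ln12; rewrite posrE addr_gt0.
Qed.

End profile_comparison.

Lemma radial_profile_inj (R : realType) (C1 d1 A1 p1 C2 d2 A2 p2 : R) :
  0 < C1 -> 0 < d1 -> 0 < A1 -> 0 < p1 ->
  0 < C2 -> 0 < d2 -> 0 < A2 -> 0 < p2 ->
  (forall x : R, 0 < x ->
    radial_profile C1 d1 A1 p1 x = radial_profile C2 d2 A2 p2 x) ->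
  [/\ C1 = C2, d1 = d2, A1 = A2 & p1 = p2].
Proof.
move=> C10 d10 A10 p10 C20 d20 A20 p20 e12.
have e21 x : 0 < x ->
  radial_profile C2 d2 A2 p2 x = radial_profile C1 d1 A1 p1 x.
  by move=> x0; rewrite e12.
have d12 : d1 = d2.
  by apply/eqP; rewrite eq_le; apply/andP; split;
    [exact: profile_exponent_le e21 | exact: profile_exponent_le e12].
have C12 : ln C1 = ln C2.
  by apply/eqP; rewrite eq_le; apply/andP; split;
    [exact: profile_constant_le e12 _ | exact: profile_constant_le e21 _].
have p12 : p1 = p2.
  by apply/eqP; rewrite eq_le; apply/andP; split;
    [exact: profile_tail_le e12 _ _ | exact: profile_tail_le e21 _ _].
split=> //; first by apply: ln_inj C12; rewrite posrE.
exact: profile_scale_eq e12 _ _ _.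
Qed.

(** * Trigonometric polynomials of degree one *)

Lemma trig_pi4 (R : realType) :
  [/\ 0 < cos (pi / 4 : R), sin (pi / 4 : R) = cos (pi / 4)
    & 2 * cos (pi / 4 : R) ^+ 2 = 1].
Proof.
have pi0 := pi_gt0 R.
have sc : sin (pi / 4 : R) = cos (pi / 4).
  by rewrite -cosBpihalf -cosN; congr cos; field.
split=> //; first by apply: cos_gt0_pihalf; apply/andP; split; lra.
by have := cos2Dsin2 (pi / 4 : R); rewrite sc; lra.
Qed.

(** The weight [1 + p * cos t + q * sin t], with [p ^+ 2 + q ^+ 2 <= 1], vanishes
    at most at one angle, namely where [(cos t, sin t) = - (p, q)] on the unit
    circle.  Hence at least three of the four angles [0], [pi / 2], [- pi / 2]
    and [pi / 4] remain, and any three of them determine the coefficients. *)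
Lemma trig_affine_eq0 (R : realType) (p q a b c : R) :
  p ^+ 2 + q ^+ 2 <= 1 ->
  (forall t, - pi < t < pi -> 1 + p * cos t + q * sin t != 0 ->
     a + b * cos t + c * sin t = 0) ->
  [/\ a = 0, b = 0 & c = 0].
Proof.
move=> pq H; have pi0 := pi_gt0 R.
have [r0 sr r2] := trig_pi4 R.
have H1 : 1 + p != 0 -> a + b = 0.
  move=> h; have := H 0; rewrite cos0 sin0 !mulr0 !mulr1 !addr0; apply=> //.
  by rewrite oppr_lt0 pi0.
have H2 : 1 + q != 0 -> a + c = 0.
  move=> h; have := H (pi / 2).
  rewrite cos_pihalf sin_pihalf !mulr0 !mulr1 !addr0; apply=> //.
  by apply/andP; split; lra.
have H3 : 1 - q != 0 -> a - c = 0.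
  move=> h; have := H (- (pi / 2)).
  rewrite cosN sinN cos_pihalf sin_pihalf !mulr0 !mulrN !mulr1 !addr0; apply=> //.
  by apply/andP; split; lra.
have H4 : 1 + (p + q) * cos (pi / 4) != 0 -> a + (b + c) * cos (pi / 4) = 0.
  move=> h; have := H (pi / 4); rewrite sr -!addrA -!mulrDl; apply=> //.
  by apply/andP; split; lra.
set r := cos (pi / 4) in r0 r2 H4.
have r1 : r < 1 by nra.
(* Discard in turn the angles 0, pi / 2 and - pi / 2; in each case the weight
   is known and is nonzero at the other three angles. *)
have [p1|/H1 e1] := eqVneq (1 + p) 0.
  have p1' : p = -1 by lra.
  have q0 : q = 0 by apply/eqP; rewrite -sqrf_eq0; apply/eqP; nra.
  have e2 : a + c = 0 by apply: H2; rewrite q0 addr0 oner_eq0.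
  have e3 : a - c = 0 by apply: H3; rewrite q0 subr0 oner_eq0.
  have e4 : a + (b + c) * r = 0 by apply: H4; apply/eqP; rewrite p1' q0; lra.
  have a0 : a = 0 by lra.
  have c0 : c = 0 by lra.
  split=> //; move/eqP: e4; rewrite a0 c0 addr0 add0r mulf_eq0 (gt_eqF r0) orbF.
  by move/eqP.
have [q1|/H2 e2] := eqVneq (1 + q) 0.
  have q1' : q = -1 by lra.
  have p0 : p = 0 by apply/eqP; rewrite -sqrf_eq0; apply/eqP; nra.
  have e3 : a - c = 0 by apply: H3; apply/eqP; lra.
  have e4 : a + (b + c) * r = 0 by apply: H4; apply/eqP; rewrite q1' p0; lra.
  have : a = 0 by nra.
  by split; lra.
have [q1|/H3 e3] := eqVneq (1 - q) 0.
  have q1' : q = 1 by lra.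
  have p0 : p = 0 by apply/eqP; rewrite -sqrf_eq0; apply/eqP; nra.
  have e4 : a + (b + c) * r = 0 by apply: H4; apply/eqP; rewrite q1' p0; lra.
  (* Here b = c = - a, and r differs from 1 / 2. *)
  have : a * (1 - 2 * r) = 0.
    have [ba ca] : b = - a /\ c = - a by split; lra.
    by rewrite -e4 ba ca; ring.
  move/eqP; rewrite mulf_eq0 => /orP[/eqP|/eqP]; first by split; lra.
  by nra.
(* At 0, pi / 2 and - pi / 2 the relations already suffice, so that pi / 4 may
   be the exceptional angle. *)
by split; lra.
Qed.

(** The difference of the two angles has cosine [1]; halving it brings it into
    [0, pi[, where the sine vanishes only at [0]. *)
Lemma polar_angle_inj (R : realType) (m1 m2 : R) :
  0 <= m1 < 2 * pi -> 0 <= m2 < 2 * pi ->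
  cos m1 = cos m2 -> sin m1 = sin m2 -> m1 = m2.
Proof.
wlog m12 : m1 m2 / m1 <= m2 => [hw|].
  have [/hw//|/ltW/hw h] := leP m1 m2.
  by move=> *; apply/esym/h.
move=> /andP[a1 b1] /andP[a2 b2] ce se.
apply/eqP; rewrite eq_le m12 leNgt; apply/negP => lt12.
have s0 : 0 < sin ((m2 - m1) / 2).
  by apply: sin_gt0_pi; apply/andP; split; lra.
have c1 : cos (((m2 - m1) / 2) *+ 2) = 1.
  rewrite (_ : _ *+ 2 = m2 - m1); last by rewrite -mulr_natr; field.
  by rewrite cosB ce se -!expr2 cos2Dsin2.
by move: c1; rewrite cos_mulr2n cos2sin2 mulr2n; nra.
Qed.

(** * The density determines the parameters *)

Section parameters.
Variable R : realType.
Implicit Types eta : param R.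

Definition skewing eta (t : R) : R := 1 + lambda eta * sin (t - mu eta).

(** The part of the leading coefficient, and below the part of the inner
    coefficient, of the radial profile that does not depend on the angle. *)
Definition profile_constant eta : R :=
  Num.sqrt (1 - kappa eta ^+ 2) / (2 * pi * sigma eta * delta eta)
  * (sigma eta)^-1 `^ ((delta eta)^-1 - 1).

Definition scale_constant eta : R :=
  tau eta / delta eta * (sigma eta)^-1 `^ (delta eta)^-1.

Lemma ssGPT_densityE eta t x : Gamma_ISA eta -> 0 <= x ->
  ssGPT_density eta (t, x) =
  radial_profile (skewing eta t * profile_constant eta) (delta eta)^-1
    (scale_constant eta * (1 - kappa eta * cos (t - mu eta)))
    (delta eta / tau eta + 1) x.
Proof.
case: eta => s d ta m k l [/= s0 d0 t0 _] x0.
rewrite /radial_profile /skewing /profile_constant /scale_constant /=.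
rewrite !powRM ?invr_ge0 ?(ltW s0) //.
congr (_ * (1 + _) `^ _); ring.
Qed.

Lemma skewing_ge0 eta t : Gamma_ISA eta -> 0 <= skewing eta t.
Proof.
case=> _ _ _ [_ _ /andP[l1 l2]]; rewrite /skewing.
have := sin_geN1 (t - mu eta); have := sin_le1 (t - mu eta).
move: (sin _) => s s1 s2; nra.
Qed.

Lemma profile_constant_gt0 eta : Gamma_ISA eta -> 0 < profile_constant eta.
Proof.
case=> s0 d0 _ [_ /andP[k0 k1] _].
rewrite /profile_constant mulr_gt0 ?powR_gt0 ?invr_gt0 //.
have k2 : 0 < 1 - kappa eta ^+ 2 by rewrite subr_gt0 exprn_ilt1 ?ltW.
by rewrite divr_gt0 ?sqrtr_gt0 // !mulr_gt0 ?pi_gt0.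
Qed.

Lemma scale_constant_gt0 eta : Gamma_ISA eta -> 0 < scale_constant eta.
Proof.
case=> s0 d0 t0 _.
by rewrite /scale_constant mulr_gt0 ?powR_gt0 ?invr_gt0 // divr_gt0.
Qed.

Lemma concentration_gt0 eta t : Gamma_ISA eta ->
  0 < 1 - kappa eta * cos (t - mu eta).
Proof.
case=> _ _ _ [_ /andP[k0 k1] _].
have := cos_geN1 (t - mu eta); have := cos_le1 (t - mu eta).
move: (cos _) => c c1 c2; nra.
Qed.

Lemma shape_gt0 eta : Gamma_ISA eta ->
  0 < (delta eta)^-1 /\ 0 < delta eta / tau eta + 1.
Proof.
by case=> _ d0 t0 _; rewrite invr_gt0; split=> //; rewrite addr_gt0 ?divr_gt0.
Qed.

(** The sign of the density tells where the skewing factor vanishes, so two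
    equal densities have the same exceptional angle. *)
Lemma density_gt0 eta t x : Gamma_ISA eta -> 0 < x ->
  (0 < ssGPT_density eta (t, x)) = (skewing eta t != 0).
Proof.
move=> eG x0; rewrite ssGPT_densityE ?(ltW x0) // /radial_profile.
have B0 : 0 < 1 + scale_constant eta * (1 - kappa eta * cos (t - mu eta))
    * x `^ (delta eta)^-1.
  apply: addr_gt0 => //.
  apply: mulr_gt0 (powR_gt0 _ x0).
  exact: mulr_gt0 (scale_constant_gt0 eG) (concentration_gt0 t eG).
rewrite (pmulr_lgt0 _ (powR_gt0 _ B0)) (pmulr_lgt0 _ (powR_gt0 _ x0)).
rewrite (pmulr_lgt0 _ (profile_constant_gt0 eG)) lt_neqAle eq_sym.
by rewrite skewing_ge0 ?andbT.
Qed.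

Lemma trig_coefficients (a1 k1 m1 a2 k2 m2 t : R) :
  a1 * (1 - k1 * cos (t - m1)) = a2 * (1 - k2 * cos (t - m2)) ->
  a1 - a2
  + (a2 * (k2 * cos m2) - a1 * (k1 * cos m1)) * cos t
  + (a2 * (k2 * sin m2) - a1 * (k1 * sin m1)) * sin t = 0.
Proof.
rewrite !cosB; set L := a1 * _; set M := a2 * _ => e.
by transitivity (L - M); [rewrite /L /M; ring | rewrite e subrr].
Qed.

Lemma skewing_coefficients eta1 eta2 t : Gamma_ISA eta1 ->
  profile_constant eta1 = profile_constant eta2 -> mu eta1 = mu eta2 ->
  skewing eta1 t * profile_constant eta1
    = skewing eta2 t * profile_constant eta2 ->
  0 + - ((lambda eta1 - lambda eta2) * sin (mu eta1)) * cos t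
  + (lambda eta1 - lambda eta2) * cos (mu eta1) * sin t = 0.
Proof.
move=> G1 <- em /mulIf h; have {h} := h (lt0r_neq0 (profile_constant_gt0 G1)).
rewrite /skewing -em sinB => /addrI; set L := lambda eta1 * _.
set M := lambda eta2 * _ => e.
by transitivity (L - M); [rewrite /L /M; ring | rewrite e subrr].
Qed.

Lemma density_param_inj eta1 eta2 : Gamma_ISA eta1 -> Gamma_ISA eta2 ->
  (forall t x, - pi < t < pi -> 0 < x ->
     ssGPT_density eta1 (t, x) = ssGPT_density eta2 (t, x)) ->
  eta1 = eta2.
Proof.
move=> G1 G2 e12.
have [d10 p10] := shape_gt0 G1; have [d20 p20] := shape_gt0 G2.
have inj t : - pi < t < pi -> skewing eta1 t != 0 ->
    [/\ skewing eta1 t * profile_constant eta1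
          = skewing eta2 t * profile_constant eta2,
      (delta eta1)^-1 = (delta eta2)^-1,
      scale_constant eta1 * (1 - kappa eta1 * cos (t - mu eta1))
        = scale_constant eta2 * (1 - kappa eta2 * cos (t - mu eta2))
    & delta eta1 / tau eta1 + 1 = delta eta2 / tau eta2 + 1].
  move=> tpi w1.
  have w2 : skewing eta2 t != 0.
    by rewrite -(density_gt0 t G2 ltr01) -e12 ?density_gt0.
  have pos eta : Gamma_ISA eta -> skewing eta t != 0 ->
      0 < skewing eta t * profile_constant eta /\
      0 < scale_constant eta * (1 - kappa eta * cos (t - mu eta)).
    move=> G w; split; last first.
      exact: mulr_gt0 (scale_constant_gt0 G) (concentration_gt0 t G).
    apply: mulr_gt0; last exact: profile_constant_gt0.
    by rewrite lt_neqAle eq_sym w skewing_ge0.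
  have [C10 A10] := pos _ G1 w1; have [C20 A20] := pos _ G2 w2.
  apply: (radial_profile_inj C10 d10 A10 p10 C20 d20 A20 p20) => x x0.
  by rewrite -!ssGPT_densityE ?e12 ?(ltW x0).
have trig0 (a b c : R) : (forall t, - pi < t < pi -> skewing eta1 t != 0 ->
    a + b * cos t + c * sin t = 0) -> [/\ a = 0, b = 0 & c = 0].
  move=> H.
  apply: (@trig_affine_eq0 _ (- (lambda eta1 * sin (mu eta1)))
    (lambda eta1 * cos (mu eta1))).
    case: G1 => _ _ _ [_ _ /andP[l1 l2]].
    rewrite sqrrN !exprMn -mulrDr addrC cos2Dsin2; nra.
  move=> t tpi; rewrite (_ : 1 + _ + _ = skewing eta1 t); first exact: H.
  by rewrite /skewing sinB; ring.
(* Otherwise the function 1 would satisfy the hypothesis of trig0. *)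
have [t0 t0pi w0] : exists2 t, - pi < t < pi & skewing eta1 t != 0.
  apply: contrapT => nw; have [] := trig0 1 0 0 _.
    by move=> t tpi wt; exfalso; apply: nw; exists t.
  by move/eqP; rewrite oner_eq0.
have [_ /invr_inj ed _ /addIr ep] := inj t0 t0pi w0.
have et : tau eta1 = tau eta2.
  move: ep; rewrite ed => /(mulfI _) h; apply: invr_inj; apply: h.
  by case: G2 => _ /gt_eqF->.
pose kc eta := kappa eta * cos (mu eta); pose ks eta := kappa eta * sin (mu eta).
have [/subr0_eq es /subr0_eq ec /subr0_eq eS] := trig0
    (scale_constant eta1 - scale_constant eta2)
    (scale_constant eta2 * kc eta2 - scale_constant eta1 * kc eta1)
    (scale_constant eta2 * ks eta2 - scale_constant eta1 * ks eta1)
    (fun t tpi wt => let: And4 _ _ h _ := inj t tpi wt in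
      trig_coefficients h).
have sc0 : scale_constant eta1 != 0 by rewrite gt_eqF ?scale_constant_gt0.
have {ec}ec : kc eta2 = kc eta1 by apply: (mulfI sc0); rewrite {1}es.
have {eS}eS : ks eta2 = ks eta1 by apply: (mulfI sc0); rewrite {1}es.
have esi : sigma eta1 = sigma eta2.
  move: es; rewrite /scale_constant -ed -et.
  have c0 : tau eta1 / delta eta1 != 0.
    by case: G1 => _ ? ? _; rewrite gt_eqF ?divr_gt0.
  move/(mulfI c0)/powR_injective => h; apply: invr_inj; apply: h => //.
  - by case: G1 => s0 _ _ _; rewrite nnegrE invr_ge0 ltW.
  - by case: G2 => s0 _ _ _; rewrite nnegrE invr_ge0 ltW.
have [k10 k20] : 0 < kappa eta1 /\ 0 < kappa eta2.
  by case: G1 G2 => _ _ _ [_ /andP[? _] _] [_ _ _ [_ /andP[? _] _]].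
have ek : kappa eta1 = kappa eta2.
  have k2 eta : kappa eta ^+ 2 = kc eta ^+ 2 + ks eta ^+ 2.
    by rewrite !exprMn -mulrDr cos2Dsin2 mulr1.
  by apply/eqP; rewrite -(eqrXn2 (n := 2)) ?ltW // !k2 ec eS.
have em : mu eta1 = mu eta2.
  have k0 : kappa eta1 != 0 by rewrite gt_eqF.
  move: ec eS; rewrite /kc /ks -ek => /(mulfI k0) ec /(mulfI k0) eS.
  case: G1 G2 => _ _ _ [m1 _ _] [_ _ _ [m2 _ _]].
  exact: polar_angle_inj.
have eK : profile_constant eta1 = profile_constant eta2.
  by rewrite /profile_constant esi ek ed.
have el : lambda eta1 = lambda eta2.
  (* The vector (dl * sin mu, dl * cos mu) vanishes, so does its length |dl|. *)
  pose dl := lambda eta1 - lambda eta2.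
  have [_ es' ec'] := trig0 0 (- (dl * sin (mu eta1))) (dl * cos (mu eta1))
    (fun t tpi wt => let: And4 h _ _ _ := inj t tpi wt in
      skewing_coefficients G1 eK em h).
  apply/subr0_eq/eqP; rewrite -/dl -sqrf_eq0 -[dl ^+ 2]mulr1.
  rewrite -(cos2Dsin2 (mu eta1)) mulrDr -!exprMn ec' -[dl * sin _]opprK es'.
  by rewrite oppr0 expr0n addr0.
case: eta1 eta2 ed et esi ek em el {G1 G2 e12 d10 d20 p10 p20 inj trig0 t0pi w0 ep
  kc ks es ec eS sc0 k10 k20 eK} => [? ? ? ? ? ?] [? ? ? ? ? ?] /=.
by move=> -> -> -> -> -> ->.
Qed.
End parameters.

(** * Integrability of powers at the origin *)

Lemma powR_continuous (R : realType) (a x : R) : 0 < x ->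
  {for x, continuous (fun y : R => y `^ a)}.
Proof.
move=> x0; apply/differentiable_continuous/derivable1_diffP.
by apply: derivable_powR; rewrite in_itv /= x0.
Qed.

Lemma integral_powR (R : realType) (d e M : R) : 0 < d -> 0 < e < M ->
  (\int[@lebesgue_measure R]_(y in (`[e, M] : set R)) (y `^ (d - 1))%:E
   = (M `^ d / d - e `^ d / d)%:E)%E.
Proof.
move=> d0 /andP[e0 eM].
have F1 (y : R) : 0 < y ->
    is_derive y 1 (fun z : R => z `^ d / d) (y `^ (d - 1)).
  move=> y0; have h := is_derive1_powR d y0.
  have -> : (fun z : R => z `^ d / d) = d^-1 *: (fun z : R => z `^ d).
    by apply/funext => z; rewrite /GRing.scale /= mulrC.
  apply: is_derive_eq; rewrite /GRing.scale /= mulrA mulVf ?mul1r //.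
  by rewrite gt_eqF.
have cF (y : R) : 0 < y -> {for y, continuous (fun z : R => z `^ d / d)}.
  move=> /F1 [dF _]; apply/differentiable_continuous.
  exact/derivable1_diffP.
rewrite (@continuous_FTC2 _ _ (fun z : R => z `^ d / d)) //.
- apply: continuous_in_subspaceT => y /set_mem /=; rewrite in_itv /= => /andP[ey _].
  by apply: powR_continuous; apply: lt_le_trans ey.
- split.
  + by move=> y; rewrite in_itv /= => /andP[ey _]; have [] := F1 y (lt_trans e0 ey).
  + exact/cvg_at_right_filter/cF.
  + exact/cvg_at_left_filter/cF/(lt_trans e0 eM).
- move=> y; rewrite in_itv /= => /andP[ey _].
  by rewrite derive1E; have [_ ->] := F1 y (lt_trans e0 ey).
Qed.

(** The primitive [y `^ d / d] has no derivative at [0], so the integral is the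
    limit of the integrals over [[M / n.+2, M]], all bounded by [M `^ d / d]. *)
Lemma integral_powR_lty (R : realType) (d M : R) : 0 < d -> 0 < M ->
  (\int[@lebesgue_measure R]_(y in (`[0%R, M] : set R)) (y `^ (d - 1))%:E < +oo)%E.
Proof.
move=> d0 M0.
have mp (D : set R) : measurable_fun D (EFin \o (fun y : R => y `^ (d - 1))).
  by apply/measurable_EFinP; apply: measurable_funTS; exact: measurable_powR.
rewrite -(@integral_itv_obnd_cbnd _ _ _ (EFin \o (fun y : R => y `^ (d - 1)))) //.
(* The index n.+2 makes every interval nondegenerate. *)
pose F (n : nat) : set R := `[M / n.+2%:R, M]%classic.
have FU : `]0, M]%classic = \bigcup_n F n.
  apply/seteqP; split => y /=; rewrite in_itv /=.
    move=> /andP[y0 yM]; exists (Num.truncn (M / y)) => //=.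
    rewrite /F /= in_itv /= yM andbT ler_pdivrMr // mulrC -ler_pdivrMr //.
    by rewrite (le_trans (ltW (truncnS_gt _))) // ler_nat.
  move=> [n _]; rewrite /F /= in_itv /= => /andP[ny ->]; rewrite andbT.
  by apply: lt_le_trans ny; rewrite divr_gt0.
have mF n : measurable (F n) by exact: measurable_itv.
have nF : nondecreasing_seq F.
  move=> m n mn; rewrite subsetEset => y; rewrite /F /= !in_itv /= => /andP[my ->].
  rewrite andbT (le_trans _ my) // ler_pM2l // lef_pV2 ?posrE //.
  by rewrite ler_nat.
have cv : (\int[@lebesgue_measure R]_(y in F n) (y `^ (d - 1))%:E
    @[n --> \oo] -->
    \int[@lebesgue_measure R]_(y in `]0%R, M]) (y `^ (d - 1))%:E)%E.
  rewrite FU; apply: ge0_nondecreasing_set_cvg_integral => //.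
  - by move=> n; exact: mp.
  - by move=> n y _; rewrite lee_fin powR_ge0.
apply: (@le_lt_trans _ _ (M `^ d / d)%:E); last exact: ltry.
rewrite -(cvg_lim _ cv) //; apply: lime_le.
  by apply/cvg_ex; eexists; exact: cv.
apply: nearW => n; rewrite integral_powR //; last first.
  by rewrite divr_gt0 //= ltr_pdivrMr // ltr_pMr // ltr1n.
by rewrite lee_fin gerBl divr_ge0 ?powR_ge0 ?ltW.
Qed.

Lemma integral_prod_snd_lty (R : realType) (A B : set R) (h : R -> R) :
  measurable A -> measurable B -> (lebesgue_measure A < +oo)%E ->
  measurable_fun B h -> (forall y, B y -> 0 <= h y) ->
  (\int[@lebesgue_measure R]_(y in B) (h y)%:E < +oo)%E ->
  (\int[(@lebesgue_measure R \x @lebesgue_measure R)%E]_(p in A `*` B)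
     (h p.2)%:E < +oo)%E.
Proof.
move=> mA mB A_lty mh h0 h_lty.
pose H : R -> \bar R := (fun y => (h y)%:E) \_ B.
have mH : measurable_fun setT H.
  by apply/(measurable_restrictT _ _).1/measurable_EFinP.
have H0 y : (0 <= H y)%E by apply: erestrict_ge0 => z Bz; rewrite lee_fin h0.
pose G (p : R * R) : \bar R := ((\1_A p.1)%:E * H p.2)%E.
have -> : (\int[(@lebesgue_measure R \x @lebesgue_measure R)%E]_(p in A `*` B)
     (h p.2)%:E = \int[(@lebesgue_measure R \x @lebesgue_measure R)%E]_p G p)%E.
  rewrite integral_mkcond; apply: eq_integral => -[t y] _.
  rewrite /G /H /patch /= indicE in_setX /=.
  case: ifP => [/andP[-> ->]|]; rewrite ?mul1e //.
  by do 2 case: (_ \in _) => //=; rewrite ?mule0 ?mul0e.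
have mG : measurable_fun setT G.
  apply: emeasurable_funM; last exact: measurableT_comp.
  by apply/measurable_EFinP; apply: measurableT_comp.
have G0 p : (0 <= G p)%E by rewrite /G mule_ge0 // lee_fin.
rewrite fubini_tonelli1 //.
under eq_integral do rewrite /fubini_F /G /= ge0_integralZl ?lee_fin //.
rewrite ge0_integralZr //; last by apply: integral_ge0.
  rewrite integral_indic // setIT lte_mul_pinfty //.
    by rewrite ge0_fin_numE.
  by rewrite /H -integral_mkcond.
by apply/measurable_EFinP.
Qed.

(** * Laws with the same distribution function *)

Section law.
Variable R : realType.
Local Notation leb := (@lebesgue_measure R).
Implicit Types (f g : R * R -> R) (A B : set (R * R)).

Lemma measurable_cylinder : measurable (@cylinder R).
Proof. by apply: measurableX; exact: measurable_itv. Qed.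

Lemma measurable_rect (I J : interval R) : measurable ([set` I] `*` [set` J]).
Proof. by apply: measurableX; exact: measurable_itv. Qed.

Lemma law_setU f A B : measurable_fun setT f ->
  (forall p, cylinder p -> 0 <= f p) ->
  measurable A -> measurable B -> A `&` B = set0 ->
  law f (A `|` B) = (law f A + law f B)%E.
Proof.
move=> mf f0 mA mB AB; rewrite /law setIUl ge0_integral_setU //.
- by apply: measurableI => //; exact: measurable_cylinder.
- by apply: measurableI => //; exact: measurable_cylinder.
- by apply/measurable_EFinP; exact: measurable_funTS.
- by move=> p [[_ Cp]|[_ Cp]]; rewrite lee_fin f0.
- by rewrite disj_set2E setIACA AB set0I.
Qed.

Lemma law_ge0 f A : (forall p, cylinder p -> 0 <= f p) -> (0 <= law f A)%E.
Proof. by move=> f0; apply: integral_ge0 => p [_ /f0]; rewrite lee_fin. Qed.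

Lemma adde_cancel (x y z : \bar R) : (0 <= x)%E -> (x < +oo)%E ->
  (x + y = x + z -> y = z)%E.
Proof.
move=> x0 x_lty e; have x_fin : x \is a fin_num by rewrite ge0_fin_numE.
by rewrite -(addeK y x_fin) -(addeK z x_fin) ![(_ + x)%E]addeC e.
Qed.

(** Inclusion-exclusion: cut a quadrant into a smaller quadrant, a half-strip
    and a rectangle.  Finiteness allows the common masses to be cancelled. *)
Lemma cdf_determines_rect f g (a b c d : R) :
  measurable_fun setT f -> measurable_fun setT g ->
  (forall p, cylinder p -> 0 <= f p) -> (forall p, cylinder p -> 0 <= g p) ->
  (forall t x, Defs.cdf f t x < +oo)%E -> Defs.cdf f = Defs.cdf g ->
  a <= b -> c <= d ->
  law f (`]a, b] `*` `]c, d]) = law g (`]a, b] `*` `]c, d]).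
Proof.
move=> mf mg f0 g0 f_lty fg ab cd.
have mrect := measurable_rect.
have strip x : law f (`]a, b] `*` `]-oo, x]) = law g (`]a, b] `*` `]-oo, x]).
  have U : `]-oo, b] `*` `]-oo, x] =
      (`]-oo, a] `*` `]-oo, x]) `|` (`]a, b] `*` `]-oo, x]) :> set (R * R).
    apply/seteqP; split=> -[t y]; rewrite /setX /= !in_itv /=.
      by move=> [tb yx]; have [ta|ta] := leP t a; [left | right]; rewrite ?tb.
    by move=> [[ta yx]|[/andP[_ tb] yx]] //; split=> //; exact: le_trans ab.
  have D : (`]-oo, a] `*` `]-oo, x]) `&` (`]a, b] `*` `]-oo, x])
      = set0 :> set (R * R).
    apply/seteqP; split=> -[t y] //; rewrite /setX /= !in_itv /=.
    by move=> [[ta _] [/andP[+ _] _]]; rewrite ltNge ta.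
  apply: (@adde_cancel (Defs.cdf f a x)) => //; first exact: law_ge0.
  rewrite {2}fg /Defs.cdf -!law_setU // -U.
  exact: (congr1 (fun h => h b x) fg).
have U : `]a, b] `*` `]-oo, d] =
    (`]a, b] `*` `]-oo, c]) `|` (`]a, b] `*` `]c, d]) :> set (R * R).
  apply/seteqP; split=> -[t y]; rewrite /setX /= !in_itv /=.
    by move=> [tb yx]; have [yc|yc] := leP y c; [left | right]; rewrite ?yx.
  by move=> [[ta yx]|[ta /andP[_ yx]]] //; split=> //; exact: le_trans cd.
have D : (`]a, b] `*` `]-oo, c]) `&` (`]a, b] `*` `]c, d]) = set0 :> set (R * R).
  apply/seteqP; split=> -[t y] //; rewrite /setX /= !in_itv /=.
  by move=> [[_ yc] [_ /andP[+ _]]]; rewrite ltNge yc.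
apply: (@adde_cancel (law f (`]a, b] `*` `]-oo, c]))); first exact: law_ge0.
  apply: le_lt_trans (f_lty b c); rewrite /Defs.cdf /law.
  apply: ge0_subset_integral.
  - by apply: measurableI; [exact: mrect | exact: measurable_cylinder].
  - by apply: measurableI; [exact: mrect | exact: measurable_cylinder].
  - by apply/measurable_EFinP; exact: measurable_funTS.
  - by move=> p [_ /f0]; rewrite lee_fin.
  - apply: setSI => -[t y]; rewrite /setX /= !in_itv /=.
    by move=> [/andP[_ ->]].
by rewrite {2}strip -!law_setU // -U strip.
Qed.

(** If [f < g] at the point, choose levels [f < m1 < m2 < g] there.  On a small
    rectangle [Q] continuity gives [f < m1] and [m2 < g], so the mass of [Q] is
    at most [m1] times its area for [f], and at least [m2] times for [g]. *)
Lemma cdf_le_density f g (t x : R) :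
  measurable_fun setT f -> measurable_fun setT g ->
  (forall p, cylinder p -> 0 <= f p) -> (forall p, cylinder p -> 0 <= g p) ->
  (forall t x, Defs.cdf f t x < +oo)%E -> Defs.cdf f = Defs.cdf g ->
  - pi < t < pi -> 0 < x ->
  {for (t, x), continuous f} -> {for (t, x), continuous g} ->
  g (t, x) <= f (t, x).
Proof.
move=> mf mg f0 g0 f_lty fg /andP[t1 t2] x0 cf cg.
rewrite leNgt; apply/negP => fltg.
pose m1 := (2 * f (t, x) + g (t, x)) / 3.
pose m2 := (f (t, x) + 2 * g (t, x)) / 3.
have [fm1 m12 m2g] : [/\ f (t, x) < m1, m1 < m2 & m2 < g (t, x)].
  by rewrite /m1 /m2; split; lra.
have N : \forall p \near (t, x),
    [/\ f p < m1, m2 < g p & - pi < p.1 < pi /\ 0 < p.2].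
  have c1 : (fun p : R * R => p.1) @ (t, x) --> t by exact: cvg_fst.
  have c2 : (fun p : R * R => p.2) @ (t, x) --> x by exact: cvg_snd.
  near=> p; split; first by near: p; exact: (cvgr_lt _ cf).
    by near: p; exact: (cvgr_gt _ cg).
  split; last by near: p; exact: (cvgr_gt _ c2).
  by apply/andP; split; near: p; [exact: (cvgr_gt _ c1)|exact: (cvgr_lt _ c1)].
have /nbhs_ballP[e /= e0 be] := N.
pose h := e / 2.
have h0 : 0 < h by rewrite divr_gt0.
have he : h < e by rewrite /h; lra.
pose Q : set (R * R) := `]t - h, t + h] `*` `]x - h, x + h].
have Qe p : Q p -> [/\ f p < m1, m2 < g p & - pi < p.1 < pi /\ 0 < p.2].
  move=> [/=]; rewrite !in_itv /= => /andP[a1 a2] /andP[b1 b2].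
  by apply: be; split; rewrite /ball /= ltr_norml; apply/andP; split; lra.
have Qcyl : Q `<=` @cylinder R.
  move=> p /Qe[_ _ [/andP[p1 p2] p3]].
  by split; rewrite /= in_itv /= ?andbT ?p2 ?andbT ltW.
have QC : Q `&` @cylinder R = Q by exact/setIidPl.
have mQ : measurable Q by exact: measurable_rect.
have vQ : ((leb \x leb)%E Q = (h * 2 * (h * 2))%:E)%E.
  have len (z : R) : leb `]z - h, z + h] = (h * 2)%:E.
    rewrite lebesgue_measure_itv /= lte_fin ifT; last by lra.
    by rewrite -EFinD; congr EFin; lra.
  by rewrite product_measure1E ?EFinM;
    [congr (_ * _)%E; exact: len | exact: measurable_itv..].
have : (law f Q < law g Q)%E.
  apply: (@le_lt_trans _ _ (m1 * (h * 2 * (h * 2)))%:E).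
    rewrite EFinM -vQ -integral_cst // /law QC; apply: ge0_le_integral => //.
    - by move=> p /Qcyl/f0; rewrite lee_fin.
    - by apply/measurable_EFinP; exact: measurable_funTS.
    - by move=> p /Qe[+ _ _]; rewrite lee_fin => /ltW.
  apply: (@lt_le_trans _ _ (m2 * (h * 2 * (h * 2)))%:E).
    by rewrite lte_fin ltr_pM2r // !mulr_gt0.
  rewrite EFinM -vQ -integral_cst // /law QC; apply: ge0_le_integral => //.
  - move=> p _; rewrite lee_fin (le_trans _ (ltW m12)) // (le_trans _ (ltW fm1)) //.
    by apply: f0; apply: Qcyl; split; rewrite /= in_itv /=; apply/andP; split; lra.
  - by apply/measurable_EFinP; exact: measurable_funTS.
  - by move=> p /Qe[_ + _]; rewrite lee_fin => /ltW.
rewrite (@cdf_determines_rect f g) ?ltxx //; lra.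
Unshelve. all: by end_near. Qed.

End law.

(** * Regularity of the density *)

Section density.
Variable R : realType.
Implicit Types eta : param R.

Lemma measurable_density eta : measurable_fun setT (ssGPT_density eta).
Proof.
case: eta => s d ta m k l.
have mtrig (h : R -> R) : continuous h ->
    measurable_fun setT (fun p : R * R => h (p.1 - m)).
  move=> ch; apply: measurableT_comp; first exact: continuous_measurable_fun.
  by apply: measurable_funB.
have mpow (a : R) : measurable_fun setT (fun p : R * R => (p.2 / s) `^ a).
  apply: (measurableT_comp (measurable_powR a)).
  by apply: measurable_funM.
have -> : ssGPT_density (Param s d ta m k l) = fun p : R * R =>
    (1 + l * sin (p.1 - m)) * (Num.sqrt (1 - k ^+ 2) / (2 * pi * s * d))
    * (p.2 / s) `^ (d^-1 - 1)
    * (1 + ta / d * (p.2 / s) `^ d^-1 * (1 - k * cos (p.1 - m)))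
      `^ (- (d / ta + 1)) by apply/funext => -[].
apply: measurable_funM.
  apply: measurable_funM => //; apply: measurable_funM => //.
  apply: measurable_funD => //; apply: measurable_funM => //.
  exact: (mtrig _ (@continuous_sin R)).
apply: (measurableT_comp (measurable_powR _)).
apply: measurable_funD => //; apply: measurable_funM.
  exact: measurable_funM.
apply: measurable_funB => //; apply: measurable_funM => //.
exact: (mtrig _ (@continuous_cos R)).
Qed.

Lemma density_continuous eta (t x : R) : Gamma_ISA eta -> 0 < x ->
  {for (t, x), continuous (ssGPT_density eta)}.
Proof.
case: eta => s d ta m k l eG x0.
have [s0 d0 t0 _] : Gamma_ISA (Param s d ta m k l) by [].
rewrite /= in s0 d0 t0.
have ctrig (h : R -> R) : continuous h ->
    {for (t, x), continuous (fun p : R * R => h (p.1 - m))}.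
  move=> ch; apply: (@continuous_comp _ _ _ (fun p : R * R => p.1 - m) h);
    last exact: ch.
  by apply: cvgB; [exact: cvg_fst | exact: cvg_cst].
have cpow (a : R) : {for (t, x), continuous (fun p : R * R => (p.2 / s) `^ a)}.
  apply: (@continuous_comp _ _ _ (fun p : R * R => p.2 / s) (fun y => y `^ a)).
    by apply: cvgM; [exact: cvg_snd | exact: cvg_cst].
  by apply: powR_continuous; rewrite divr_gt0.
have -> : ssGPT_density (Param s d ta m k l) = fun p : R * R =>
    (1 + l * sin (p.1 - m)) * (Num.sqrt (1 - k ^+ 2) / (2 * pi * s * d))
    * (p.2 / s) `^ (d^-1 - 1)
    * (1 + ta / d * (p.2 / s) `^ d^-1 * (1 - k * cos (p.1 - m)))
      `^ (- (d / ta + 1)) by apply/funext => -[].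
have B0 := concentration_gt0 t eG; rewrite /= in B0.
have C0 : {for (t, x), continuous (fun p : R * R =>
    1 + ta / d * (p.2 / s) `^ d^-1 * (1 - k * cos (p.1 - m)))}.
  apply: cvgD; first exact: cvg_cst.
  apply: cvgM; first by apply: cvgM; [exact: cvg_cst | exact: cpow].
  apply: cvgB; first exact: cvg_cst.
  by apply: cvgM; [exact: cvg_cst | exact: (ctrig _ (@continuous_cos R))].
apply: cvgM.
  apply: cvgM; last exact: cpow.
  apply: cvgM; last exact: cvg_cst.
  apply: cvgD; first exact: cvg_cst.
  by apply: cvgM; [exact: cvg_cst | exact: (ctrig _ (@continuous_sin R))].
apply: (@continuous_comp _ _ _ _ (fun y : R => y `^ (- (d / ta + 1))) _ C0).
apply: powR_continuous.
by rewrite addr_gt0 // !mulr_gt0 ?powR_gt0 ?divr_gt0 ?invr_gt0.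
Qed.

Lemma density_ge0 eta p : Gamma_ISA eta -> cylinder p ->
  0 <= ssGPT_density eta p.
Proof.
case: p => t x eG [_]; rewrite /= in_itv /= andbT => x0.
rewrite ssGPT_densityE // /radial_profile mulr_ge0 ?powR_ge0 //.
by rewrite mulr_ge0 ?powR_ge0 // mulr_ge0 ?skewing_ge0 // ltW ?profile_constant_gt0.
Qed.

(** The skewing factor is at most [2], and the bracket, which is at least [1],
    is raised to a negative power. *)
Lemma density_le_powR eta t x : Gamma_ISA eta -> 0 <= x ->
  ssGPT_density eta (t, x)
    <= 2 * profile_constant eta * x `^ ((delta eta)^-1 - 1).
Proof.
move=> eG x0; rewrite ssGPT_densityE // /radial_profile.
have K0 := ltW (profile_constant_gt0 eG).
have w2 : skewing eta t <= 2.
  case: (eG) => _ _ _ [_ _ /andP[l1 l2]]; rewrite /skewing.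
  have := sin_geN1 (t - mu eta); have := sin_le1 (t - mu eta).
  by move: (sin _) => s s1 s2; nra.
have w0 := skewing_ge0 t eG.
have [_ p0] := shape_gt0 eG.
have B1 : 1 <= 1 + scale_constant eta * (1 - kappa eta * cos (t - mu eta))
    * x `^ (delta eta)^-1.
  rewrite lerDl; apply: mulr_ge0 (powR_ge0 _ _).
  exact: mulr_ge0 (ltW (scale_constant_gt0 eG)) (ltW (concentration_gt0 t eG)).
apply: (@le_trans _ _ (skewing eta t * profile_constant eta
    * x `^ ((delta eta)^-1 - 1))).
  rewrite ler_piMr //.
    exact: mulr_ge0 (mulr_ge0 w0 K0) (powR_ge0 _ _).
  rewrite -[leRHS](powRr0 (1 + scale_constant eta
    * (1 - kappa eta * cos (t - mu eta)) * x `^ (delta eta)^-1)).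
  by rewrite ler_powR // oppr_le0 ltW.
apply: ler_wpM2r (powR_ge0 _ _) _ _ _.
exact: ler_wpM2r.
Qed.

Lemma cdf_density_lty eta t x : Gamma_ISA eta ->
  (Defs.cdf (ssGPT_density eta) t x < +oo)%E.
Proof.
move=> eG; rewrite /Defs.cdf /law; have [d0 _] := shape_gt0 eG.
(* The maximum with 1 only serves to have a nondegenerate interval when
   x is not positive. *)
pose M : R := Num.max x 1.
have M0 : 0 < M by rewrite lt_max ltr01 orbT.
pose D : set (R * R) := `[- pi, pi[ `*` `[0, M].
have mD : measurable D.
  by apply: measurableX; exact: measurable_itv.
have mf (E : set (R * R)) : measurable_fun E (EFin \o ssGPT_density eta).
  by apply/measurable_EFinP; apply: measurable_funTS; exact: measurable_density.
have inD p : D p -> cylinder p.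
  move=> [? /=]; rewrite in_itv /= => /andP[p0 _].
  by split; rewrite //= in_itv /= p0.
apply: (@le_lt_trans _ _ (\int[(@lebesgue_measure R \x @lebesgue_measure R)%E]_(p
    in D) (ssGPT_density eta p)%:E)%E).
  apply: ge0_subset_integral.
  - apply: measurableI; last exact: measurable_cylinder.
    by apply: measurableX; exact: measurable_itv.
  - exact: mD.
  - exact: mf.
  - by move=> p /inD /(density_ge0 eG); rewrite lee_fin.
  - move=> -[u y]; rewrite /D /setX /cylinder /= !in_itv /= andbT.
    by move=> [[_ yx] [-> ->]]; split; rewrite // le_max yx.
pose h y := 2 * profile_constant eta * y `^ ((delta eta)^-1 - 1) : R.
have K0 : 0 <= 2 * profile_constant eta.
  by rewrite mulr_ge0 // ltW ?profile_constant_gt0.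
have mh (E : set R) : measurable_fun E h.
  by apply: measurable_funTS; apply: measurable_funM => //; exact: measurable_powR.
have h0 y : 0 <= h y := mulr_ge0 K0 (powR_ge0 _ _).
apply: (@le_lt_trans _ _ (\int[(@lebesgue_measure R \x @lebesgue_measure R)%E]_(p
    in D) (h p.2)%:E)%E).
  apply: ge0_le_integral => //.
  - by move=> p /inD /(density_ge0 eG); rewrite lee_fin.
  - exact: mf.
  - have mh2 : measurable_fun setT (fun p : R * R => h p.2).
      exact: (measurableT_comp (mh setT) measurable_snd).
    by apply/measurable_EFinP; exact: measurable_funTS mh2.
  - move=> [u y] [_ /=]; rewrite in_itv /= => /andP[y0 _].
    by rewrite lee_fin; exact: density_le_powR.
apply: integral_prod_snd_lty => //.
  by rewrite lebesgue_measure_itv /=; case: ifP => // _; rewrite -EFinB ltry.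
rewrite /h; under eq_integral do rewrite EFinM.
rewrite ge0_integralZl_EFin //.
- by rewrite lte_mul_pinfty ?lee_fin // integral_powR_lty.
- by move=> y _; rewrite lee_fin powR_ge0.
- by apply/measurable_EFinP; apply: measurable_funTS; exact: measurable_powR.
Qed.

Lemma density_eq_of_cdf_eq eta1 eta2 t x :
  Gamma_ISA eta1 -> Gamma_ISA eta2 ->
  Defs.cdf (ssGPT_density eta1) = Defs.cdf (ssGPT_density eta2) ->
  - pi < t < pi -> 0 < x -> ssGPT_density eta1 (t, x) = ssGPT_density eta2 (t, x).
Proof.
move=> G1 G2 e12 tpi x0; have m1 := measurable_density eta1.
have m2 := measurable_density eta2.
have f1 p := @density_ge0 eta1 p G1; have f2 p := @density_ge0 eta2 p G2.
have l1 u y := cdf_density_lty u y G1; have l2 u y := cdf_density_lty u y G2.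
have c1 := @density_continuous eta1 t x G1 x0.
have c2 := @density_continuous eta2 t x G2 x0.
by apply/eqP; rewrite eq_le (cdf_le_density m2 m1) ?(cdf_le_density m1 m2).
Qed.

End density.

Theorem proposition7 (R : realType) :
  @identifiable R (param R) (@Gamma_ISA R) (@ssGPT_density R).
Proof.
move=> eta1 eta2 G1 G2 neq e12; apply: neq.
apply: density_param_inj => // t x tpi x0.
exact: density_eq_of_cdf_eq.
Qed.
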